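(* There exists an absolute constant $c>0$ such that for every positive integer $k$ there exist a planar graph $G=(V,E,\ell)$ with nonnegative edge lengths (namely, the $k\times k$ grid with suitable edge lengths) and a set $R\subseteq V$ of $k$ terminals with the following property: every planar graph $H$ with nonnegative edge lengths such that $R\subseteq V(H)$ and $d_H(u,v)=d_G(u,v)$ for all $u,v\in R$ has at least $ck^2$ vertices. In particular, $f^*(k,\mathrm{Planar})\ge ck^2$, where $\mathrm{Planar}$ is the family of all planar graphs.
   Context: $d_H$ denotes shortest-path distance in a graph $H$ with respect to its edge lengths. Given a graph $G=(V,E,\ell)$ and terminals $R\subseteq V$, a distance-preserving minor of $G$ with respect to $R$ is a graph $G'$ with edge lengths $\ell'$ (which may differ from $\ell$) such that $G'$ is a minor of $G$ in which the terminals survive (terminals are never deleted and no two terminals are merged; a terminal may be merged with non-terminals by contraction and the resulting vertex is identified with that terminal), so $R\subseteq V(G')$, and $d_{G'}(u,v)=d_G(u,v)$ for all $u,v\in R$. For a family $\mathcal{F}$ of graphs, $f^*(k,\mathcal{F})$ is the minimum number such that every graph in $\mathcal{F}$, with any nonnegative edge lengths and any $k$ terminals, admits a distance-preserving minor with at most $f^*(k,\mathcal{F})$ vertices. *)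

(* Defs.v *)
From HB Require Import structures.
From mathcomp Require Import all_boot all_order all_algebra.
From mathcomp Require Import all_classical all_reals all_analysis.

Set Implicit Arguments.
Unset Strict Implicit.
Unset Printing Implicit Defensive.

Import Order.TTheory GRing.Theory Num.Theory.
Import numFieldNormedType.Exports.

Local Open Scope classical_set_scope.
Local Open Scope ring_scope.

Record sgraph := SGraph {
  vertex :> finType;
  adj : rel vertex;
  adj_sym : symmetric adj;
  adj_irrefl : irreflexive adj }.

Arguments adj {s} x y.

(* The plane is R * R with its product topology.  [arc x y] is only meaningful
   when x and y are adjacent; [arc y x] is the same arc run backwards, so that
   each edge {x, y} is drawn once. *)
Record plane_drawing (R : realType) (G : sgraph)
    (pos : G -> R * R) (arc : G -> G -> R -> R * R) : Prop := PlaneDrawing {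
  pos_inj : injective pos;
  arc_continuous : forall x y, adj x y ->
    {within `[0, 1]%classic, continuous (arc x y)};
  arc_inj : forall x y, adj x y ->
    forall s t, 0 <= s <= 1 -> 0 <= t <= 1 -> arc x y s = arc x y t -> s = t;
  arc_src : forall x y, adj x y -> arc x y 0 = pos x;
  arc_tgt : forall x y, adj x y -> arc x y 1 = pos y;
  arc_rev : forall x y, adj x y ->
    forall t, 0 <= t <= 1 -> arc y x t = arc x y (1 - t);
  arc_avoids_vertices : forall x y z t, adj x y ->
    0 < t < 1 -> arc x y t <> pos z;
  arc_disjoint : forall x y x' y' s t, adj x y -> adj x' y' ->
    [set x; y]%SET != [set x'; y']%SET ->
    0 < s < 1 -> 0 < t < 1 -> arc x y s <> arc x' y' t }.

Definition planar (R : realType) (G : sgraph) : Prop :=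
  exists pos arc, @plane_drawing R G pos arc.

(* The length of the edge {x, y} is [ell [set x; y]]; the values of [ell] on
   other sets of vertices are irrelevant. *)
Definition nonneg_lengths (R : realType) (G : sgraph)
    (ell : {set G} -> R) : Prop :=
  forall x y : G, adj x y -> 0 <= ell [set x; y]%SET.

Fixpoint walk_length (R : realType) (G : sgraph) (ell : {set G} -> R)
    (x : G) (p : seq G) : R :=
  if p is y :: q then ell [set x; y]%SET + walk_length ell y q else 0.

Definition is_path (G : sgraph) (u v : G) (p : seq G) : bool :=
  [&& path adj u p, uniq (u :: p) & last u p == v].

(* +oo when u and v are not connected; otherwise the infimum is a minimum,
   since there are finitely many simple paths. *)
Definition dist (R : realType) (G : sgraph) (ell : {set G} -> R)
    (u v : G) : \bar R :=
  ereal_inf [set (walk_length ell u p)%:E | p in [set p | is_path u v p]].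

(* In the three operations below, I indexes the terminals, which are the
   vertices t1 i of G1 and become the vertices t2 i of G2; G2 is described up
   to isomorphism. *)

Definition vertex_deletion (I : Type) (G1 : sgraph) (t1 : I -> G1)
    (G2 : sgraph) (t2 : I -> G2) : Prop :=
  exists (f : G2 -> G1) (v : G1),
    [/\ injective f,
        forall x, (exists y, f y = x) <-> x <> v,
        forall a b, adj a b = adj (f a) (f b)
      & forall i, f (t2 i) = t1 i].

Definition edge_deletion (I : Type) (G1 : sgraph) (t1 : I -> G1)
    (G2 : sgraph) (t2 : I -> G2) : Prop :=
  exists (f : G2 -> G1) (x y : G1),
    [/\ bijective f,
        adj x y,
        forall a b, adj a b =
          adj (f a) (f b) && ([set f a; f b]%SET != [set x; y]%SET)
      & forall i, f (t2 i) = t1 i].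

Definition edge_contraction (I : Type) (G1 : sgraph) (t1 : I -> G1)
    (G2 : sgraph) (t2 : I -> G2) : Prop :=
  exists (f : G1 -> G2) (x y : G1),
    adj x y /\
    [/\ forall a, exists u, f u = a,
        forall u v, f u = f v <-> u = v \/ [set u; v]%SET = [set x; y]%SET,
        forall a b, adj a b <->
          a <> b /\ exists u v, [/\ f u = a, f v = b & adj u v],
        forall i, f (t1 i) = t2 i
      & injective t2].

Inductive terminal_minor (I : Type) (G : sgraph) (t : I -> G) :
    forall G' : sgraph, (I -> G') -> Prop :=
| TM_iso (G' : sgraph) (t' : I -> G') (f : G -> G') :
    bijective f -> (forall x y, adj (f x) (f y) = adj x y) ->
    (forall i, f (t i) = t' i) -> terminal_minor t t'
| TM_vertex (G1 G2 : sgraph) (t1 : I -> G1) (t2 : I -> G2) :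
    terminal_minor t t1 -> vertex_deletion t1 t2 -> terminal_minor t t2
| TM_edge (G1 G2 : sgraph) (t1 : I -> G1) (t2 : I -> G2) :
    terminal_minor t t1 -> edge_deletion t1 t2 -> terminal_minor t t2
| TM_contract (G1 G2 : sgraph) (t1 : I -> G1) (t2 : I -> G2) :
    terminal_minor t t1 -> edge_contraction t1 t2 -> terminal_minor t t2.

Definition terminals (G : sgraph) (S : {set G}) : Type := {x : G | x \in S}.

(* The inclusion of S in V(H) is given by an injection t. *)
Definition preserves_dist (R : realType) (G : sgraph) (ell : {set G} -> R)
    (S : {set G}) (H : sgraph) (ellH : {set H} -> R)
    (t : terminals S -> H) : Prop :=
  forall u v : terminals S,
    dist ellH (t u) (t v) = dist ell (sval u) (sval v).

Definition dp_minor (R : realType) (G : sgraph) (ell : {set G} -> R)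
    (S : {set G}) (G' : sgraph) (ell' : {set G'} -> R)
    (t : terminals S -> G') : Prop :=
  [/\ nonneg_lengths ell',
      terminal_minor (fun u : terminals S => sval u) t
    & preserves_dist ell ell' t].

Definition dp_minor_bound (R : realType) (k : nat) (F : sgraph -> Prop)
    (n : nat) : Prop :=
  forall (G : sgraph) (ell : {set G} -> R) (S : {set G}),
    F G -> nonneg_lengths ell -> #|S| = k ->
    exists (G' : sgraph) (ell' : {set G'} -> R) (t : terminals S -> G'),
      dp_minor ell ell' t /\ (#|G'| <= n)%N.

(* The minimum of the admissible bounds, and +oo if there were none. *)
Definition fstar (R : realType) (k : nat) (F : sgraph -> Prop) : \bar R :=
  ereal_inf [set (n%:R : R)%:E | n in [set n | dp_minor_bound R k F n]].

Definition consecutive (i j : nat) : bool := (i.+1 == j) || (j.+1 == i).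

Definition grid_adj (k : nat) : rel ('I_k * 'I_k) := fun x y =>
  (x.1 == y.1) && consecutive x.2 y.2 || (x.2 == y.2) && consecutive x.1 y.1.

Lemma consecutive_sym (i j : nat) : consecutive i j = consecutive j i.
Proof. exact: orbC. Qed.

Lemma consecutive_irrefl (i : nat) : consecutive i i = false.
Proof. by rewrite /consecutive orbb gtn_eqF. Qed.

Lemma grid_adj_sym (k : nat) : symmetric (@grid_adj k).
Proof.
move=> x y; rewrite /grid_adj (eq_sym x.1) (eq_sym x.2).
by rewrite (consecutive_sym x.1) (consecutive_sym x.2).
Qed.

Lemma grid_adj_irrefl (k : nat) : irreflexive (@grid_adj k).
Proof. by move=> x; rewrite /grid_adj !consecutive_irrefl !andbF. Qed.

Definition grid (k : nat) : sgraph :=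
  SGraph (@grid_adj_sym k) (@grid_adj_irrefl k).

(* Main.v *)
Require Import Defs.
From mathcomp Require Import all_boot all_order all_algebra.
From mathcomp Require Import all_classical all_reals all_analysis.
From mathcomp Require Import zify ring lra.

Set Implicit Arguments.
Unset Strict Implicit.
Unset Printing Implicit Defensive.

Import Order.TTheory GRing.Theory Num.Theory.
Import numFieldNormedType.Exports.

Local Open Scope ring_scope.

(* In the grid, take terminals a_i and b_j on two adjacent sides, with lengths
   making the distances strictly Monge: d(a_i, b_j) +
   d(a_i', b_j') < d(a_i, b_j') + d(a_i', b_j) for i < i' and j < j'.  If H has
   the same distances, fix shortest paths P_ij in H.  Two such paths P_ij and
   P_i'j' meeting in a vertex could be recombined there, so a given vertex lies
   on no two of them with i < i' and j < j', hence on O(k) paths, hence on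
   O(k^2) pairs of paths.  But a planar graph has the property that among any
   nine walks joining three vertices to three vertices, two with no common end
   meet; counting the pairs over all 3 x 3 choices of terminals gives
   |H| = Omega(k^2).

   That property is proved by van Kampen's parity argument: if independent
   curves were disjoint, then for each independent pair (f, g) the vector
   f(s) - g(t) would not vanish on the square, so its winding along the boundary
   would be zero; summed mod 2 over all independent pairs the contributions of
   the vertex-edge sides cancel, while those of the vertex-vertex directions add
   up to 1.  Unlike a planar drawing, the property passes at once to minors,
   walks being lifted through the branch sets; this gives the bound on f^*. *)

(** * Parity of crossings of polygons *)

Section Crossing.
Variable R : realFieldType.
Implicit Types (p q r u x y : R * R) (s t : seq (R * R)).

Definition upper p : bool := (0 < p.2) || (p.2 == 0) && (0 < p.1).
Definition det p q : R := p.1 * q.2 - p.2 * q.1.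
Definition dot p q : R := p.1 * q.1 + p.2 * q.2.

(* The segment from [p] to [q] crosses the ray of angle 0; meaningful only if
   [p] and [q] lie in a common open half-plane. *)
Definition crosses p q : bool :=
  (upper p != upper q) && ((0 < det p q) == upper q).

Lemma upperN p : p != 0 -> upper (- p) = ~~ upper p.
Proof.
case: p => a b; rewrite /upper /= oppr_gt0 oppr_eq0 oppr_gt0 => nz.
have {}nz : (b == 0) ==> (a != 0).
  by apply/implyP => /eqP b0; apply: contraNneq nz => a0; rewrite a0 b0.
by move: nz; case: ltrgtP => //= _; case: ltrgtP.
Qed.

Lemma crossesN p q : p != 0 -> q != 0 ->
  crosses (- p) (- q) = crosses p q (+) (upper p (+) upper q).
Proof.
move=> p0 q0; rewrite /crosses !upperN // (_ : det (- p) (- q) = det p q).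
  by case: (upper p); case: (upper q); case: (0 < _).
by rewrite /det /=; ring.
Qed.

Lemma upper_comb (a b c : R) p q r : 0 < a -> 0 < b -> 0 < c ->
  a * p.1 + b * q.1 = c * r.1 -> a * p.2 + b * q.2 = c * r.2 ->
  upper p = upper q -> upper r = upper p.
Proof.
case: p => p1 p2; case: q => q1 q2; case: r => r1 r2 a0 b0 c0 /= e1 e2.
rewrite /upper /=; case: (ltrgtP p2 0) => p20; case: (ltrgtP q2 0) => q20 //=.
- have : r2 < 0 by nra.
  by case: ltrgtP.
- have : r2 < 0 by nra.
  by case: ltrgtP.
- have : 0 < r2 by nra.
  by case: ltrgtP.
- have : 0 < r2 by nra.
  by case: ltrgtP.
- have : r2 < 0 by nra.
  by case: ltrgtP => // _ _ /esym.
- have : 0 < r2 by nra.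
  by case: ltrgtP => // _ _ /esym.
- have r20 : r2 = 0 by nra.
  rewrite r20 ltxx eqxx /=.
  case: (ltrP 0 p1) => p10 /esym; case: (ltrP 0 q1) => // q10 _; nra.
Qed.

Lemma crosses_sym u p q : 0 < dot u p -> 0 < dot u q ->
  crosses p q = crosses q p.
Proof.
move=> up uq; rewrite /crosses eq_sym.
have -> : det q p = - det p q by rewrite /det; ring.
rewrite oppr_gt0; case: ltrgtP => [_|_|d0].
- by case: (upper p); case: (upper q).
- by case: (upper p); case: (upper q).
- have -> : upper q = upper p; last by rewrite eqxx.
  apply: (@upper_comb (dot u q) (dot u q) (2 * dot u p) p p q) => //; first lra.
    have : (dot u q) * p.1 - (dot u p) * q.1 = u.2 * det p q.
      by rewrite /dot /det; ring.
    by rewrite -d0; lra.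
  have : (dot u q) * p.2 - (dot u p) * q.2 = - u.1 * det p q.
    by rewrite /dot /det; ring.
  by rewrite -d0; lra.
Qed.

Lemma det_sign u p q r : 0 < dot u p -> 0 < dot u q -> 0 < dot u r ->
  upper p = upper q -> 0 < det q r -> 0 < det r p -> upper r = upper p.
Proof.
move=> up uq ur epq qr rp.
have e1 : det q r * p.1 + det r p * q.1 = - det p q * r.1.
  by rewrite /det; ring.
have e2 : det q r * p.2 + det r p * q.2 = - det p q * r.2.
  by rewrite /det; ring.
apply: (upper_comb qr rp _ e1 e2 epq).
have : det q r * dot u p + det r p * dot u q = - det p q * dot u r.
  by rewrite /dot /det; ring.
by nra.
Qed.

Lemma crosses_triangle_same u p q r :
  0 < dot u p -> 0 < dot u q -> 0 < dot u r ->
  upper p = upper q -> crosses p r = crosses q r.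
Proof.
move=> up uq ur epq; rewrite /crosses epq.
case: (eqVneq (upper q) (upper r)) => //= nqr.
have dC x y : det x y = - det y x by rewrite /det; ring.
have nz x : 0 < dot u x -> upper x = upper q -> det x r != 0.
  move=> ux eqx; apply/eqP => d0; case/eqP: nqr; rewrite -eqx; apply/esym.
  apply: (@upper_comb (dot u r) (dot u r) (2 * dot u x) x x r) => //; first lra.
    have : (dot u r) * x.1 - (dot u x) * r.1 = u.2 * det x r.
      by rewrite /dot /det; ring.
    by rewrite d0; lra.
  have : (dot u r) * x.2 - (dot u x) * r.2 = - u.1 * det x r.
    by rewrite /dot /det; ring.
  by rewrite d0; lra.
have := nz p up epq; have := nz q uq erefl.
case: (ltrgtP (det p r) 0) => // pr; case: (ltrgtP (det q r) 0) => // qr _ _.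
- have rp : 0 < det r p by rewrite dC oppr_gt0.
  by have := det_sign up uq ur epq qr rp; rewrite epq => e; rewrite e eqxx in nqr.
- have rq : 0 < det r q by rewrite dC oppr_gt0.
  have := det_sign uq up ur (esym epq) pr rq.
  by move=> e; rewrite e eqxx in nqr.
Qed.

Lemma crosses_triangle u p q r :
  0 < dot u p -> 0 < dot u q -> 0 < dot u r ->
  crosses p q (+) crosses q r = crosses p r.
Proof.
move=> up uq ur.
have c0 x y : upper x = upper y -> crosses x y = false.
  by rewrite /crosses => ->; rewrite eqxx.
have [epq|npq] := eqVneq (upper p) (upper q).
  by rewrite c0 // (crosses_triangle_same up uq ur epq).
have [eqr|nqr] := eqVneq (upper q) (upper r).
  rewrite (c0 q r) // addbF (crosses_sym up uq) (crosses_sym up ur).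
  exact: (crosses_triangle_same uq ur up eqr).
have epr : upper p = upper r.
  by move: npq nqr; case: (upper p); case: (upper q); case: (upper r).
by rewrite (crosses_sym uq ur) (crosses_triangle_same up ur uq) // addbb c0.
Qed.

Fixpoint crossings x s : bool :=
  if s is y :: s' then crosses x y (+) crossings y s' else false.

Lemma crossingsN x s : x != 0 -> all (predC1 0) s ->
  crossings (- x) (map -%R s) =
    crossings x s (+) (upper x (+) upper (last x s)).
Proof.
elim: s x => [|y s IH] x x0 /=; first by rewrite addbb.
case/andP => y0 s0; rewrite IH // crossesN //.
by case: (crosses _ _); case: (crossings _ _); case: (upper x); case: (upper y);
   case: (upper _).
Qed.

Definition sup_close (e : R) : rel (R * R) :=
  fun x y => (`|x.1 - y.1| <= e) && (`|x.2 - y.2| <= e).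

Lemma dot_gt0 (d : R) u p :
  0 <= d -> ~~ sup_close (2 * d) u 0 -> sup_close d u p -> 0 < dot u p.
Proof.
case: u => a b; case: p => a' b' d0; rewrite /sup_close /dot /= !subr0.
rewrite negb_and -!ltNge => far /andP[]; rewrite !ler_norml.
move=> /andP[h1 h2] /andP[h3 h4].
have key (v w w' : R) : 2 * d < `|v| -> `|w| <= `|v| -> - d <= w - w' <= d ->
    - (`|v| * d) <= w * (w' - w).
  move=> dv wv /andP[l1 l2].
  have h : `|w * (w' - w)| <= `|v| * d.
    by rewrite normrM ler_pM // ler_norml; lra.
  by rewrite lerNl; apply: le_trans h; rewrite -normrN ler_norm.
have fin (v w v' w' : R) : 2 * d < `|v| -> `|w| <= `|v| -> - d <= v - v' <= d ->
    - d <= w - w' <= d -> 0 < v * v' + w * w'.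
  move=> dv wv hv hw; have := key v w w' dv wv hw.
  have := key v v v' dv (lexx _) hv.
  have : `|v| ^+ 2 = v ^+ 2 by rewrite real_normK // num_real.
  by have := sqr_ge0 w; have := normr_ge0 v; nra.
have H1 : - d <= a - a' <= d by rewrite h1.
have H2 : - d <= b - b' <= d by rewrite h3.
case: (lerP `|b| `|a|) => ab.
  by apply: fin => //; case/orP: far => //; lra.
by rewrite addrC; apply: fin => //; rewrite ?ltW //; case/orP: far => //; lra.
Qed.

Lemma sup_close_refl (e : R) x : 0 <= e -> sup_close e x x.
Proof. by move=> e0; rewrite /sup_close !subrr normr0 e0. Qed.

Lemma sup_closeB (e : R) x x' y y' :
  sup_close e x x' -> sup_close e y y' -> sup_close (2 * e) (x - y) (x' - y').
Proof.
case: x x' y y' => [? ?] [? ?] [? ?] [? ?].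
rewrite /sup_close /= !ler_norml => /andP[/andP[? ?] /andP[? ?]].
move=> /andP[/andP[? ?] /andP[? ?]].
by apply/andP; split; apply/andP; split; lra.
Qed.

Lemma sup_close_sub0 (e : R) x y : sup_close e (x - y) 0 = sup_close e x y.
Proof. by rewrite /sup_close /= !subr0. Qed.

Section Square.
Variables (e : R) (e0 : 0 <= e).

Definition far s t := forall x y, x \in s -> y \in t -> ~~ sup_close (4 * e) x y.

Lemma cell_crosses x x' y y' : ~~ sup_close (4 * e) x y ->
  sup_close e x x' -> sup_close e y y' ->
  crosses (x - y) (x' - y) (+) crosses (x' - y) (x' - y') =
  crosses (x - y) (x - y') (+) crosses (x - y') (x' - y').
Proof.
move=> fxy xx' yy'.
have D z z' : sup_close e x z -> sup_close e y z' -> 0 < dot (x - y) (z - z').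
  move=> xz yz; apply: (@dot_gt0 (2 * e)); first by rewrite mulr_ge0.
    by rewrite sup_close_sub0 mulrA -natrM.
  exact: sup_closeB.
have xx := sup_close_refl x e0; have yy := sup_close_refl y e0.
by rewrite !(@crosses_triangle (x - y)) // D.
Qed.

Lemma strip_crossings x s y y' : path (sup_close e) x s -> sup_close e y y' ->
  far (x :: s) [:: y] ->
  crossings (x - y) [seq z - y | z <- s] (+)
    crosses (last x s - y) (last x s - y') =
  crosses (x - y) (x - y') (+) crossings (x - y') [seq z - y' | z <- s].
Proof.
move=> + yy'; elim: s x => [|x' s IH] x /=; first by rewrite addbF.
case/andP=> xx' ps fs.
have fxy : ~~ sup_close (4 * e) x y by apply: fs; rewrite ?inE ?eqxx.
rewrite -addbA IH //; last first.
  by move=> z z' zs; apply: fs; rewrite inE zs orbT.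
by rewrite !addbA cell_crosses.
Qed.

Lemma square_crossings x s y t : path (sup_close e) x s -> path (sup_close e) y t ->
  far (x :: s) (y :: t) ->
  crossings (x - y) [seq z - y | z <- s] (+)
    crossings (last x s - y) [seq last x s - z | z <- t] =
  crossings (x - y) [seq x - z | z <- t] (+)
    crossings (x - last y t) [seq z - last y t | z <- s].
Proof.
move=> ps; elim: t y => [|y' t IH] y /=; first by rewrite addbF.
case/andP=> yy' pt fst; rewrite addbA strip_crossings //; last first.
  by move=> z z' zs; rewrite inE => /eqP ->; apply: fst; rewrite ?inE ?eqxx.
rewrite -!addbA IH //.
by move=> z z' zs zt; apply: fst => //; rewrite inE zt orbT.
Qed.

Lemma crossings_opp x y t : far [:: x] (y :: t) ->
  crossings (x - y) [seq x - z | z <- t] =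
  crossings (y - x) [seq z - x | z <- t] (+)
    (upper (y - x) (+) upper (last y t - x)).
Proof.
move=> fxt.
have nz z : z \in y :: t -> z - x != 0.
  move=> zt; apply/eqP => /subr0_eq zx.
  by have := fxt x z (mem_head _ _) zt; rewrite zx sup_close_refl // mulr_ge0.
have -> : last y t - x = last (y - x) [seq z - x | z <- t] 
  by rewrite (last_map (fun z => z - x)).
rewrite -crossingsN ?nz ?mem_head //; last first.
  by apply/allP => _ /mapP[z zt ->]; rewrite /= nz // inE zt orbT.
rewrite opprB -map_comp; congr crossings.
by apply/eq_map => z /=; rewrite opprB.
Qed.

Lemma square_upper x s y t : path (sup_close e) x s -> path (sup_close e) y t ->
  far (x :: s) (y :: t) ->
  let cr v z c := crossings (z - v) [seq w - v | w <- c] in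
  cr y x s (+) cr (last y t) x s (+) cr x y t (+) cr (last x s) y t =
  upper (y - x) (+) upper (last y t - x) (+)
    upper (y - last x s) (+) upper (last y t - last x s).
Proof.
move=> ps pt fst cr; have := square_crossings ps pt fst.
rewrite !crossings_opp -/(cr y x s) -/(cr (last y t) x s) -/(cr x y t)
  -/(cr (last x s) y t).
- move: (cr y x s) (cr (last y t) x s) (cr x y t) (cr (last x s) y t).
  move: (upper (y - x)) (upper (last y t - x)) (upper (y - last x s)).
  by move: (upper (_ - _)) => [] [] [] [] [] [] [] [].
- by move=> z w; rewrite inE => /eqP ->; apply: fst; rewrite mem_head.
- by move=> z w; rewrite inE => /eqP ->; apply: fst; rewrite mem_last.
Qed.

End Square.

Lemma K33_parity (na nb : 'I_3 -> 'I_3 -> 'I_3 -> bool)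
    (ua ub uab uba : 'I_3 -> 'I_3 -> bool) :
  (forall j l, j != l -> ub l j = ~~ ub j l) ->
  (forall i j k l, i != k -> j != l ->
    na k i j (+) nb l i j (+) na i k l (+) nb j k l =
    ua k i (+) uab l i (+) uba k j (+) ub l j) -> False.
Proof.
move=> ubN E.
pose o0 := @Ordinal 3 0 isT; pose o1 := @Ordinal 3 1 isT.
pose o2 := @Ordinal 3 2 isT.
have {}E i j k l : i != k -> j != l ->
    na k i j + nb l i j + na i k l + nb j k l =
    ua k i + uab l i + uba k j + ub l j.
  exact: E.
have {}ubN j l : j != l -> ub l j = ub j l + 1.
  by move=> /ubN ->; case: (ub _ _).
pose B i := nb o0 i o1 + nb o0 i o2 + nb o1 i o0 + nb o1 i o2 + nb o2 i o0
  + nb o2 i o1.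
have F i k : i != k -> B i + B k = 1.
  move=> ik.
  have e1 := E i o0 k o1 ik isT; have e2 := E i o0 k o2 ik isT.
  have e3 := E i o1 k o0 ik isT; have e4 := E i o1 k o2 ik isT.
  have e5 := E i o2 k o0 ik isT; have e6 := E i o2 k o1 ik isT.
  rewrite (ubN o0 o1 isT) in e1; rewrite (ubN o0 o2 isT) in e2.
  rewrite (ubN o1 o2 isT) in e4.
  have two : 2 = 0 :> bool by [].
  pose L := na k i o0 + na k i o1 + na k i o2 + na i k o0 + na i k o1
    + na i k o2.
  pose M := 3 * ua k i + uab o0 i + uab o1 i + uab o2 i + uba k o0 + uba k o1
    + uba k o2 + ub o0 o1 + ub o0 o2 + ub o1 o2 + 1.
  suff : B i + B k + 2 * L = 1 + 2 * M by rewrite two !mul0r !addr0.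
  have esum (x1 y1 x2 y2 x3 y3 x4 y4 x5 y5 x6 y6 : bool) : x1 = y1 -> x2 = y2 ->
      x3 = y3 -> x4 = y4 -> x5 = y5 -> x6 = y6 ->
      x1 + x2 + x3 + x4 + x5 + x6 = y1 + y2 + y3 + y4 + y5 + y6 :> bool.
    by do 6 move=> ->.
  have := esum _ _ _ _ _ _ _ _ _ _ _ _ e1 e2 e3 e4 e5 e6.
  rewrite (_ : _ + _ + _ + _ + _ + _ = B i + B k + 2 * L); last first.
    by rewrite /B /L; ring.
  by move=> ->; rewrite /M; ring.
have := F o0 o1 isT; have := F o1 o2 isT; have := F o0 o2 isT.
by case: (B o0); case: (B o1); case: (B o2).
Qed.

Lemma K33_polygons (e : R) (a b : 'I_3 -> R * R) (s : 'I_3 -> 'I_3 -> seq (R * R)) :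
  0 <= e -> (forall i j, path (sup_close e) (a i) (s i j)) ->
  (forall i j, last (a i) (s i j) = b j) ->
  exists i j k l, [/\ i != k, j != l &
    exists x y, [/\ x \in a i :: s i j, y \in a k :: s k l & sup_close (4 * e) x y]].
Proof.
move=> e0 ps ls; apply: contrapT => H.
have fs i j k l : i != k -> j != l -> far e (a i :: s i j) (a k :: s k l).
  move=> ik jl x y xs ys; apply/negP => xy; apply: H.
  by exists i, j, k, l; split=> //; exists x, y.
pose n v i j := crossings (a i - v) [seq w - v | w <- s i j].
apply: (@K33_parity (fun k => n (a k)) (fun l => n (b l))
  (fun k i => upper (a k - a i)) (fun l j => upper (b l - b j))
  (fun l i => upper (b l - a i)) (fun k j => upper (a k - b j))).
- move=> j l jl; rewrite -opprB upperN //; apply/eqP => /subr0_eq bjl.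
  have := @fs ord0 j ord_max l isT jl (b j) (b l).
  rewrite -{1}(ls ord0 j) -{1}(ls ord_max l) !mem_last bjl sup_close_refl ?mulr_ge0 //.
  by move=> /(_ isT isT).
- move=> i j k l ik jl.
  have := square_upper e0 (ps i j) (ps k l) (fs _ _ _ _ ik jl).
  by rewrite !ls.
Qed.

End Crossing.

(** * Walks in a plane drawing *)

Section Arcs.
Local Open Scope classical_set_scope.
Variable R : realType.
Implicit Types (f g : R -> R * R) (e : R).

Lemma sup_closeW e d (x y : R * R) : d <= e -> sup_close d x y -> sup_close e x y.
Proof.
by move=> de /andP[xy1 xy2]; apply/andP; split; exact: le_trans de.
Qed.

Lemma sup_close_sym e (x y : R * R) : sup_close e x y = sup_close e y x.
Proof. by rewrite /sup_close distrC (distrC y.2). Qed.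

Lemma sup_close_trans e d (x y z : R * R) :
  sup_close e x y -> sup_close d y z -> sup_close (e + d) x z.
Proof.
move=> /andP[xy1 xy2] /andP[yz1 yz2]; apply/andP; split.
  by apply: le_trans (ler_distD y.1 _ _) _; exact: lerD.
by apply: le_trans (ler_distD y.2 _ _) _; exact: lerD.
Qed.

Lemma within_sup_close f e (s : R) : {within `[0, 1], continuous f} -> 0 < e ->
  0 <= s <= 1 -> \forall t \near s, 0 <= t <= 1 -> sup_close e (f s) (f t).
Proof.
move=> cf e0 s01.
have cfs : f x @[x --> within `[0, 1] (nbhs s)] --> f s.
  by move: cf => /subspace_continuousP; apply; rewrite /= in_itv.
have /cfs H : nbhs (f s) (ball (f s) e) by exact: nbhsx_ballx.
move: H; rewrite /nbhs /= /within /=; apply: filterS => t H t01.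
by have [|/ltW h1 /ltW h2] := H _; [rewrite in_itv | apply/andP].
Qed.

Lemma unit_near_covering : near_covering_within (`[0, 1] : set R).
Proof.
by apply/near_covering_withinP/compact_near_coveringP; exact: segment_compact.
Qed.

Lemma uniform_sup_close f e : {within `[0, 1], continuous f} -> 0 < e ->
  \forall n \near \oo, forall s t : R, 0 <= s <= 1 -> 0 <= t <= 1 ->
    `|s - t| <= n.+1%:R^-1 -> sup_close e (f s) (f t).
Proof.
move=> cf e0.
have H (s : R) : `[0, 1] s -> \forall s' \near s & n \near \oo, `[0, 1] s' ->
    forall t : R, 0 <= t <= 1 -> `|s' - t| <= n.+1%:R^-1 ->
    sup_close e (f s') (f t).
  rewrite /= in_itv /= => s01.
  have e20 : 0 < e / 2 by rewrite divr_gt0.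
  have /nbhs_ballP[d /= d0 Hd] := within_sup_close cf e20 s01.
  have d20 : 0 < d / 2 by rewrite divr_gt0.
  exists (ball s (d / 2), [set n : nat | n.+1%:R^-1 < d / 2]) => /=.
    split; first exact: nbhsx_ballx.
    by have := near_infty_natSinv_lt (PosNum d20).
  move=> [s' n] /= [ss' nd]; rewrite in_itv /= => s'01 t t01 s't.
  have h1 : sup_close (e / 2) (f s) (f s').
    apply: Hd => //; apply: lt_le_trans ss' _; lra.
  have h2 : sup_close (e / 2) (f s) (f t).
    apply: Hd => //; rewrite /ball /=.
    apply: le_lt_trans (ler_distD s' _ _) _.
    rewrite [ltRHS](splitr d); apply: ltr_leD; last exact: le_trans s't (ltW nd).
    exact: ss'.
  by rewrite (splitr e); apply: sup_close_trans h2; rewrite sup_close_sym.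
have := @unit_near_covering nat \oo (fun n s => forall t : R, 0 <= t <= 1 ->
  `|s - t| <= n.+1%:R^-1 -> sup_close e (f s) (f t)) _ H.
move=> cov; apply: filterS (cov _) => n Hn s t s01 t01.
by apply: Hn => //; rewrite /= in_itv.
Qed.

Lemma separated_from (A : set (R * R)) f : {within `[0, 1], continuous f} ->
  (forall s : R, 0 <= s <= 1 ->
    \forall e \near 0^'+, forall y, A y -> ~~ sup_close e (f s) y) ->
  \forall e \near 0^'+, forall (s : R) y, 0 <= s <= 1 -> A y -> ~~ sup_close e (f s) y.
Proof.
move=> cf HA.
have H (s : R) : `[0, 1] s -> \forall s' \near s & e \near 0^'+, `[0, 1] s' ->
    forall y, A y -> ~~ sup_close e (f s') y.
  rewrite /= in_itv /= => s01.
  have : \forall e \near 0^'+, 0 < e /\ forall y, A y -> ~~ sup_close e (f s) y.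
    by near=> e; split; [near: e; exact: nbhs_right_gt | near: e; exact: HA].
  case/filter_ex => e [e0 He].
  have e20 : 0 < e / 2 by rewrite divr_gt0.
  exists ([set s' | 0 <= s' <= 1 -> sup_close (e / 2) (f s) (f s')],
          [set d : R | d < e / 2]) => /=.
    split; first exact: within_sup_close.
    exact: nbhs_right_lt.
  move=> [s' d] /= [ss' de]; rewrite in_itv /= => s'01 y Ay.
  apply: contra (He y Ay) => h; rewrite (splitr e).
  by apply: sup_close_trans (ss' s'01) _; apply: sup_closeW h; exact: ltW.
have := @unit_near_covering R 0^'+
  (fun e s => forall y, A y -> ~~ sup_close e (f s) y) _ H.
move=> cov; apply: filterS (cov _) => e He s y s01.
by apply: He; rewrite /= in_itv.
Unshelve. all: by end_near. Qed.

Lemma arcs_separated f g : {within `[0, 1], continuous f} ->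
  {within `[0, 1], continuous g} ->
  (forall s t : R, 0 <= s <= 1 -> 0 <= t <= 1 -> f s <> g t) ->
  \forall e \near 0^'+, forall s t : R, 0 <= s <= 1 -> 0 <= t <= 1 ->
    ~~ sup_close e (f s) (g t).
Proof.
move=> cf cg fg.
have := @separated_from [set g t | t in `[0, 1]] f cf.
move=> H; have {H} : \forall e \near 0^'+, forall (s : R) y, 0 <= s <= 1 -> [set g t | t in `[0, 1]] y -> ~~ sup_close e (f s) y.
  apply: H => s s01.
  have := @separated_from [set f s] g cg.
  move=> H; have {H} : \forall e \near 0^'+, forall (t : R) y, 0 <= t <= 1 -> [set f s] y -> ~~ sup_close e (g t) y.
    apply: H => t t01.
    have far_lt (x y : R) : x != y -> \forall e \near 0^'+, e < `|x - y|.
      by move=> xy; apply: nbhs_right_lt; rewrite normr_gt0 subr_eq0.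
    have [E1|N1] := eqVneq (g t).1 (f s).1; last first.
      apply: filterS (far_lt _ _ N1) => e he y ->.
      by rewrite negb_and -!ltNge he.
    have [E2|N2] := eqVneq (g t).2 (f s).2; last first.
      apply: filterS (far_lt _ _ N2) => e he y ->.
      by rewrite negb_and -!ltNge he orbT.
    case: (fg s t s01 t01); move: E1 E2.
    by case: (f s); case: (g t) => ? ? ? ? /= -> ->.
  apply: filterS => e He y /= [t]; rewrite in_itv /= => t01 <-.
  by rewrite sup_close_sym; exact: He.
apply: filterS => e He s t s01 t01.
by apply: He => //; exists t => //=; rewrite in_itv.
Qed.
End Arcs.

Definition K33_crossing (G : sgraph) : Prop :=
  forall (a b : 'I_3 -> G) (p : 'I_3 -> 'I_3 -> seq G),
    (forall i j, path adj (a i) (p i j)) ->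
    (forall i j, last (a i) (p i j) = b j) ->
    exists i j k l, [/\ i != k, j != l &
      exists v, v \in a i :: p i j /\ v \in a k :: p k l].

Lemma path_map_iota (T : Type) (r : rel T) (f : nat -> T) (m n : nat) :
  (forall i, (m <= i < m + n)%N -> r (f i) (f i.+1)) ->
  path r (f m) [seq f i.+1 | i <- iota m n].
Proof.
elim: n m => [//|n IH] m H /=; rewrite H; last by rewrite leqnn addnS ltnS leq_addr.
by apply: IH => i /andP[mi im]; apply: H; rewrite ltnW //= addnS -addSn.
Qed.

Lemma last_map_iota (T : Type) (f : nat -> T) (m n : nat) :
  last (f m) [seq f i.+1 | i <- iota m n] = f (m + n)%N.
Proof. by elim: n m => [|n IH] m /=; rewrite ?addn0 // IH addSnnS. Qed.

Section Sampling.
Local Open Scope classical_set_scope.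
Variables (R : realType) (G : sgraph).
Variables (pos : G -> R * R) (arc : G -> G -> R -> R * R).
Hypothesis drawing : plane_drawing pos arc.

Definition refl_adj : rel G := fun x y => (x == y) || adj x y.

Definition refl_arc (x y : G) : R -> R * R :=
  if x == y then fun=> pos x else arc x y.

Lemma refl_arc_continuous x y :
  refl_adj x y -> {within `[0, 1], continuous (refl_arc x y)}.
Proof.
rewrite /refl_adj /refl_arc; case: eqP => [_ _|_ /= xy].
  by apply: continuous_subspaceT => z; exact: cst_continuous.
exact: arc_continuous drawing _ _ xy.
Qed.

Lemma refl_arc0 x y : refl_adj x y -> refl_arc x y 0 = pos x.
Proof.
rewrite /refl_adj /refl_arc; case: eqP => // _ /= xy.
exact: arc_src drawing _ _ xy.
Qed.

Lemma refl_arc1 x y : refl_adj x y -> refl_arc x y 1 = pos y.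
Proof.
rewrite /refl_adj /refl_arc; case: eqP => [->//|_ /= xy].
exact: arc_tgt drawing _ _ xy.
Qed.

Lemma refl_arcP x y s : refl_adj x y -> 0 <= s <= 1 ->
  (exists2 z, z \in [:: x; y] & refl_arc x y s = pos z) \/
  [/\ adj x y, 0 < s < 1 & refl_arc x y s = arc x y s].
Proof.
move=> xy /andP[]; rewrite !le_eqVlt => /orP[/eqP <- _|s0].
  by left; exists x; rewrite ?mem_head // refl_arc0.
case/orP=> [/eqP ->|s1].
  by left; exists y; rewrite ?inE ?eqxx ?orbT // refl_arc1.
move: xy; rewrite /refl_adj /refl_arc; case: eqP => [->|_ /= xy].
  by left; exists y; rewrite ?mem_head.
by right; split=> //; rewrite s0.
Qed.

Lemma refl_arc_disjoint x y x' y' s t : refl_adj x y -> refl_adj x' y' ->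
  (forall z, z \in [:: x; y] -> z \notin [:: x'; y']) ->
  0 <= s <= 1 -> 0 <= t <= 1 -> refl_arc x y s <> refl_arc x' y' t.
Proof.
move=> xy xy' D s01 t01.
have [[z zxy ->]|[axy s01' ->]] := refl_arcP xy s01;
  have [[z' zxy' ->]|[axy' t01' ->]] := refl_arcP xy' t01.
- by move/(pos_inj drawing) => E; have := D z zxy; rewrite E zxy'.
- by move=> /esym; exact: arc_avoids_vertices drawing _ _ z t axy' t01'.
- exact: arc_avoids_vertices drawing _ _ z' s axy s01'.
- apply: arc_disjoint drawing _ _ _ _ _ _ axy axy' _ s01' t01'.
  apply/eqP => /setP /(_ x); rewrite !inE eqxx /=.
  by have := D x (mem_head _ _); rewrite !inE => /negbTE ->.
Qed.

Variables (n : nat) (e : R).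
Hypothesis fine : forall x y, refl_adj x y -> forall s t : R,
  0 <= s <= 1 -> 0 <= t <= 1 -> `|s - t| <= n.+1%:R^-1 ->
  sup_close e (refl_arc x y s) (refl_arc x y t).

Definition arc_sample x y : seq (R * R) :=
  [seq refl_arc x y (i.+1%:R / n.+1%:R) | i <- iota 0 n.+1].

Lemma arc_sample_path x y :
  refl_adj x y -> path (sup_close e) (pos x) (arc_sample x y).
Proof.
move=> xy; have <- : refl_arc x y (0%:R / n.+1%:R) = pos x.
  by rewrite mul0r refl_arc0.
apply: (path_map_iota (f := fun i => refl_arc x y (i%:R / n.+1%:R))) => i.
rewrite add0n => /andP[_ lin].
have I j : (j <= n.+1)%N -> 0 <= (j%:R / n.+1%:R : R) <= 1.
  move=> jn; rewrite divr_ge0 ?ler0n //= ler_pdivrMr ?ltr0n // mul1r.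
  by rewrite ler_nat.
apply: fine => //; [exact/I/ltnW | exact: I | ].
rewrite -mulrBl -natr1 opprD addNKr mulN1r normrN ger0_norm //.
Qed.

Lemma last_arc_sample x y :
  refl_adj x y -> last (pos x) (arc_sample x y) = pos y.
Proof.
move=> xy; have <- : refl_arc x y (0%:R / n.+1%:R) = pos x.
  by rewrite mul0r refl_arc0.
rewrite (last_map_iota (fun i => refl_arc x y (i%:R / n.+1%:R))) add0n.
by rewrite divff ?refl_arc1 // pnatr_eq0.
Qed.

Lemma arc_sampleP x y z : z \in arc_sample x y ->
  exists2 s, 0 <= s <= 1 & z = refl_arc x y s.
Proof.
case/mapP=> i; rewrite mem_iota add0n => /andP[_ lin] ->.
exists (i.+1%:R / n.+1%:R) => //.
rewrite divr_ge0 ?ler0n //= ler_pdivrMr ?ltr0n // mul1r.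
by rewrite ler_nat.
Qed.

Fixpoint walk_sample (x : G) (p : seq G) : seq (R * R) :=
  if p is y :: q then arc_sample x y ++ walk_sample y q else [::].

Lemma walk_sample_cons x y p :
  walk_sample x (y :: p) = arc_sample x y ++ walk_sample y p.
Proof. by []. Qed.

Lemma walk_sample_path x p :
  path adj x p -> path (sup_close e) (pos x) (walk_sample x p).
Proof.
elim: p x => [//|y p IH] x; rewrite walk_sample_cons => /andP[xy yp].
have rxy : refl_adj x y by rewrite /refl_adj xy orbT.
by rewrite cat_path arc_sample_path // last_arc_sample // IH.
Qed.

Lemma last_walk_sample x p :
  path adj x p -> last (pos x) (walk_sample x p) = pos (last x p).
Proof.
elim: p x => [//|y p IH] x; rewrite walk_sample_cons => /andP[xy yp].
have rxy : refl_adj x y by rewrite /refl_adj xy orbT.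
by rewrite last_cat last_arc_sample // IH.
Qed.

Lemma walk_sampleP x p z : path adj x p -> z \in pos x :: walk_sample x p ->
  exists u v, [/\ refl_adj u v, u \in x :: p, v \in x :: p &
    exists2 s, 0 <= s <= 1 & z = refl_arc u v s].
Proof.
move=> xp; rewrite inE => /orP[/eqP ->|].
  exists x, x; rewrite /refl_adj eqxx mem_head; split=> //.
  by exists 0; rewrite ?lexx ?ler01 // /refl_arc eqxx.
elim: p x xp => [//|y p IH] x /andP[xy yp]; rewrite walk_sample_cons mem_cat.
case/orP => [/arc_sampleP H|/(IH _ yp)[u [v [uv up vp H]]]].
  by exists x, y; rewrite /refl_adj xy orbT !inE !eqxx orbT.
by exists u, v; rewrite uv !(in_cons x) up vp !orbT.
Qed.

End Sampling.

Section PlanarK33.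
Local Open Scope classical_set_scope.

Lemma planar_K33_crossing (R : realType) (G : sgraph) :
  planar R G -> K33_crossing G.
Proof.
move=> [pos [arc D]] a b p ap lp.
have sep (q : (G * G) * (G * G)) : \forall e \near 0^'+,
    refl_adj q.1.1 q.1.2 -> refl_adj q.2.1 q.2.2 ->
    (forall z, z \in [:: q.1.1; q.1.2] -> z \notin [:: q.2.1; q.2.2]) ->
    forall s t : R, 0 <= s <= 1 -> 0 <= t <= 1 ->
    ~~ sup_close e (refl_arc pos arc q.1.1 q.1.2 s)
                   (refl_arc pos arc q.2.1 q.2.2 t).
  case: q => -[x y] [x' y'] /=.
  case: (boolP (refl_adj x y)) => xy; last exact: nearW.
  case: (boolP (refl_adj x' y')) => xy'; last exact: nearW.
  case: (boolP (all (fun z => z \notin [:: x'; y']) [:: x; y])) => /allP d;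
    last exact: nearW.
  have dis s t : 0 <= s <= 1 -> 0 <= t <= 1 ->
      refl_arc pos arc x y s <> refl_arc pos arc x' y' t.
    exact: refl_arc_disjoint.
  have := arcs_separated (refl_arc_continuous D xy) (refl_arc_continuous D xy') dis.
  by apply: filterS => e He _ _ _.
have [e [He e0]] := filter_ex (filterI (filter_forall _ sep)
  (@nbhs_right_gt R 0)).
have e40 : 0 < e / 4 by rewrite divr_gt0.
have unif (q : G * G) : \forall n \near \oo, refl_adj q.1 q.2 ->
    forall s t : R, 0 <= s <= 1 -> 0 <= t <= 1 -> `|s - t| <= n.+1%:R^-1 ->
    sup_close (e / 4) (refl_arc pos arc q.1 q.2 s) (refl_arc pos arc q.1 q.2 t).
  case: q => x y /=.
  case: (boolP (refl_adj x y)) => xy; last exact: nearW.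
  have := uniform_sup_close (refl_arc_continuous D xy) e40.
  by apply: filterS => n Hn _.
have [n Hn] := filter_ex (filter_forall _ unif).
have fine x y : refl_adj x y -> forall s t : R,
  0 <= s <= 1 -> 0 <= t <= 1 -> `|s - t| <= n.+1%:R^-1 ->
  sup_close (e / 4) (refl_arc pos arc x y s) (refl_arc pos arc x y t).
  exact: (Hn (x, y)).
have [||i [j [k [l [ik jl [x [y [xs ys]]]]]]]] := @K33_polygons R (e / 4)
    (pos \o a) (pos \o b)
    (fun i j => walk_sample pos arc n (a i) (p i j)) (ltW e40).
- by move=> i j; exact: walk_sample_path D _ _ fine _ _ (ap i j).
- by move=> i j; rewrite (last_walk_sample D) // lp.
rewrite mulrC divfK // => xy.
exists i, j, k, l; split=> //.
have [u [v [uv up vp [s s01 xE]]]] := walk_sampleP (ap i j) xs.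
have [u' [v' [uv' up' vp' [t t01 yE]]]] := walk_sampleP (ap k l) ys.
apply: contrapT => N; move: xy; apply/negP; rewrite xE yE.
apply: (He ((u, v), (u', v'))) => //= z zuv; apply/negP => zuv'; apply: N.
exists z; split; [move: zuv | move: zuv']; rewrite !inE => /orP[] /eqP -> //.
Qed.

End PlanarK33.

(** * Minors *)

(* [r u a] says that [u] lies in the branch set of [a], and [c a] is a chosen
   vertex of that branch set. *)
Lemma K33_crossing_branch (G1 G2 : sgraph) (r : G1 -> G2 -> Prop)
    (c : G2 -> G1) :
  (forall u a a', r u a -> r u a' -> a = a') -> (forall a, r (c a) a) ->
  (forall a a', adj a a' -> exists q, [/\ path adj (c a) q,
    last (c a) q = c a' & forall u, u \in q -> r u a \/ r u a']) ->
  K33_crossing G1 -> K33_crossing G2.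
Proof.
move=> r_fun rc lift K1 a b p ap lp.
have walk_lift a0 p0 : path adj a0 p0 -> exists q, [/\ path adj (c a0) q,
    last (c a0) q = c (last a0 p0) &
    forall u, u \in c a0 :: q -> exists2 a', a' \in a0 :: p0 & r u a'].
  elim: p0 a0 => [|a1 p1 IH] a0 /=.
    move=> _; exists [::]; split=> // u; rewrite inE => /eqP ->.
    by exists a0; rewrite ?mem_head.
  case/andP=> /lift[q [pq lq rq]] /IH[q' [pq' lq' rq']].
  exists (q ++ q'); rewrite cat_path last_cat lq pq; split=> // u.
  rewrite -cat_cons mem_cat inE => /orP[/orP[/eqP ->|/rq[ru|ru]]|uq'].
  - by exists a0; rewrite ?mem_head.
  - by exists a0; rewrite ?mem_head.
  - by exists a1; rewrite // !inE eqxx orbT.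
  - have [|a' a'p ra'] := rq' u; first by rewrite inE uq' orbT.
    by exists a'; rewrite // inE a'p orbT.
have /choice[Q HQ] ij := walk_lift (a ij.1) (p ij.1 ij.2) (ap ij.1 ij.2).
have [||i [j [k [l [ik jl [u [u1 u2]]]]]]] :=
  K1 (c \o a) (c \o b) (fun i j => Q (i, j)).
- by move=> i j; have [] := HQ (i, j).
- by move=> i j; have [_ + _] := HQ (i, j); rewrite lp.
exists i, j, k, l; split=> //.
have [_ _ /(_ u u1)[a1 a1p ra1]] := HQ (i, j).
have [_ _ /(_ u u2)[a2 a2p ra2]] := HQ (k, l).
by exists a1; split=> //; rewrite (r_fun _ _ _ ra1 ra2).
Qed.

Lemma K33_crossing_inj (G1 G2 : sgraph) (f : G2 -> G1) : injective f ->
  (forall a b, adj a b -> adj (f a) (f b)) ->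
  K33_crossing G1 -> K33_crossing G2.
Proof.
move=> f_inj fadj; apply: (@K33_crossing_branch _ _ (fun u a => u = f a) f).
- by move=> u a a' -> /f_inj.
- by [].
- move=> a a' /fadj aa'; exists [:: f a']; rewrite /= aa'; split=> // u.
  by rewrite inE => /eqP; right.
Qed.

Lemma K33_crossing_contraction (I : Type) (G1 G2 : sgraph)
    (t1 : I -> G1) (t2 : I -> G2) :
  edge_contraction t1 t2 -> K33_crossing G1 -> K33_crossing G2.
Proof.
move=> [f [x [y [xy [f_surj f_fib f_adj _ _]]]]].
have /choice[c cK] := f_surj.
apply: (@K33_crossing_branch _ _ (fun u a => f u = a) c).
- by move=> u a a' -> ->.
- exact: cK.
have fiber u v : f u = f v -> exists q, [/\ path adj u q, last u q = v &
    forall w, w \in q -> f w = f v].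
  move=> fuv; have [->|E] := (f_fib u v).1 fuv.
    by exists [::].
  exists [:: v] => /=; split=> //; last by move=> w; rewrite inE => /eqP ->.
  rewrite andbT; have [uv|uv] := eqVneq u v.
    move: E xy; rewrite uv finset.setUid => /setP E.
    have := E x; have := E y; rewrite !inE !eqxx orbT /= => /eqP -> /eqP ->.
    by rewrite adj_irrefl.
  move/setP: E => E.
  have := E u; have := E v; rewrite !inE !eqxx orbT /= => /esym h1 /esym h2.
  case/orP: h1 h2 uv => /eqP -> /orP[] /eqP ->; rewrite ?eqxx //.
  by rewrite adj_sym.
move=> a a' /f_adj[_ [u [v [fu fv uv]]]].
have [|q [pq lq fq]] := fiber (c a) u; first by rewrite cK.
have [|q' [pq' lq' fq']] := fiber v (c a'); first by rewrite cK.
exists (q ++ v :: q'); rewrite cat_path last_cat lq /= pq uv pq'; split=> // w.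
rewrite mem_cat inE => /orP[/fq ->|/orP[/eqP ->|/fq' ->]]; rewrite ?cK; tauto.
Qed.

Lemma K33_crossing_minor (I : Type) (G G' : sgraph) (t : I -> G)
    (t' : I -> G') :
  terminal_minor t t' -> K33_crossing G -> K33_crossing G'.
Proof.
move=> m K; elim: m => {G' t'}
  [G' t' f f_bij fadj _|G1 G2 t1 t2 _ IH [f [v [f_inj _ fadj _]]]
  |G1 G2 t1 t2 _ IH [f [x [y [f_bij _ fadj _]]]]|G1 G2 t1 t2 _ IH].
- case: f_bij => g fK gK; apply: K33_crossing_inj K; first exact: can_inj gK.
  by move=> a b; rewrite -fadj !gK.
- by apply: (K33_crossing_inj f_inj _ IH) => a b; rewrite fadj.
- apply: K33_crossing_inj IH; first exact: bij_inj f_bij.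
  by move=> a b; rewrite fadj => /andP[].
- by move/K33_crossing_contraction; apply.
Qed.

(** * Distances *)

Section Distances.
Variables (R : realType) (G : sgraph) (ell : {set G} -> R).
Hypothesis ell_ge0 : nonneg_lengths ell.

Lemma walk_length_cat x p q :
  walk_length ell x (p ++ q) = walk_length ell x p + walk_length ell (last x p) q.
Proof. by elim: p x => [|y p IH] x /=; rewrite ?add0r // IH addrA. Qed.

Lemma walk_length_ge0 x p : path adj x p -> 0 <= walk_length ell x p.
Proof.
by elim: p x => [//|y p IH] x /= /andP[xy yp]; rewrite addr_ge0 ?IH ?ell_ge0.
Qed.

Lemma simple_path_exists x p : path adj x p ->
  exists q, is_path x (last x p) q /\ walk_length ell x q <= walk_length ell x p.
Proof.
elim: p x => [|y p IH] x /=; first by exists [::]; rewrite /is_path /= eqxx.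
case/andP=> xy /IH[q [/and3P[yq uq /eqP lq] qp]].
have [xq|xq] := boolP (x \in y :: q); last first.
  exists (y :: q); split; last by rewrite /= lerD2l.
  by apply/and3P; rewrite /= xy yq -lq eqxx xq; split.
case/splitPl: q / xq yq uq lq qp => q1 q2 xq1.
rewrite cat_path last_cat xq1 -cat_cons lastI xq1 cat_rcons cat_uniq.
move=> /andP[yq1 xq2] /and3P[_ _ uq2] lq; rewrite walk_length_cat xq1 => qp.
exists q2; split; first by apply/and3P; rewrite lq eqxx.
by have := walk_length_ge0 yq1; have := ell_ge0 xy; lra.
Qed.

Lemma dist_le_walk x p : path adj x p ->
  (dist ell x (last x p) <= (walk_length ell x p)%:E)%E.
Proof.
case/simple_path_exists => q [xq qp].
have h : (dist ell x (last x p) <= (walk_length ell x q)%:E)%E.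
  by apply: ereal_inf_lbound; exists q.
by apply: (le_trans h); rewrite lee_fin.
Qed.

Lemma dist_attained x y (d : R) : dist ell x y = d%:E ->
  exists p, is_path x y p /\ walk_length ell x p = d.
Proof.
move=> xyd.
have /contrapT[p0 xyp0] : ~ ~ exists p, is_path x y p.
  move=> N; move: xyd; rewrite /dist (_ : [set p | _]%classic = set0).
    by rewrite image_set0 ereal_inf0.
  by rewrite -subset0 => p xyp; apply: N; exists p.
have bound p : is_path x y p -> (size p <= #|G|)%N.
  case/and3P=> _ /card_uniqP E _; have := max_card (mem (x :: p)).
  by rewrite E => /ltnW.
pose P (p : #|G|.-bseq G) := is_path x y p.
pose q := [arg min_(p < Bseq (bound p0 xyp0) | P p) walk_length ell x p]%O.
have [Pq minq] : P q /\ forall p, P p -> walk_length ell x q <= walk_length ell x p.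
  by rewrite /q; case: arg_minP.
exists q; split=> //; apply/EFin_inj; rewrite -xyd; apply/eqP.
rewrite eq_le; apply/andP; split; last by apply: ereal_inf_lbound; exists (val q).
apply/ereal_infP => _ [p xyp <-]; rewrite lee_fin.
exact: (minq (Bseq (bound p xyp))).
Qed.

(* The two walks exchange their tails at [v]. *)
Lemma dist_exchange x y x' y' p p' v :
  is_path x y p -> is_path x' y' p' -> v \in x :: p -> v \in x' :: p' ->
  (dist ell x y' + dist ell x' y <=
    (walk_length ell x p + walk_length ell x' p')%:E)%E.
Proof.
move=> /and3P[xp _ /eqP lp] /and3P[xp' _ /eqP lp'].
move=> vp vp'.
case/splitPl: p / vp xp lp => q1 q2 lq1; rewrite cat_path last_cat lq1.
case/andP=> xq1 vq2 lq2.
case/splitPl: p' / vp' xp' lp' => q1' q2' lq1'; rewrite cat_path last_cat lq1'.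
case/andP=> xq1' vq2' lq2'.
have h1 : (dist ell x y' <= (walk_length ell x (q1 ++ q2'))%:E)%E.
  have := @dist_le_walk x (q1 ++ q2'); rewrite cat_path last_cat lq1 lq2'.
  by apply; rewrite xq1.
have h2 : (dist ell x' y <= (walk_length ell x' (q1' ++ q2))%:E)%E.
  have := @dist_le_walk x' (q1' ++ q2); rewrite cat_path last_cat lq1' lq2.
  by apply; rewrite xq1'.
apply: (le_trans (leeD h1 h2)).
by rewrite -EFinD lee_fin !walk_length_cat lq1 lq1'; lra.
Qed.

End Distances.

Lemma I3_third (i k : 'I_3) : i != k ->
  forall g, [\/ g = i, g = k | g = inord (3 - i - k)].
Proof.
move=> ik g; have [->|gi] := eqVneq g i; first by constructor 1.
have [->|gk] := eqVneq g k; first by constructor 2.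
constructor 3; apply: val_inj; rewrite /= inordK;
  by move: ik gi gk (ltn_ord i) (ltn_ord k) (ltn_ord g); rewrite -!val_eqE /=; lia.
Qed.

Lemma ffun3_eq (T : Type) (x x' : {ffun 'I_3 -> T}) (i k : 'I_3) : i != k ->
  x i = x' i -> x k = x' k -> x (inord (3 - i - k)) = x' (inord (3 - i - k)) ->
  x = x'.
Proof. by move=> ik xi xk xg; apply/ffunP => g; case: (I3_third ik g) => ->. Qed.

Definition diagonal (m : nat) (e : 'I_m * 'I_m) : 'I_(m + m) :=
  Ordinal (leq_add (ltn_ord e.1) (leq_subr e.2 m)).

Lemma diagonal_inj (m : nat) (T : pred ('I_m * 'I_m)) :
  (forall e f, T e -> T f -> (e.1 < f.1)%N -> (e.2 < f.2)%N -> False) ->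
  {in T &, injective (@diagonal m)}.
Proof.
move=> chain [i j] [i' j'] Te Tf /(congr1 val) E0.
have {E0} E : (i + (m - j) = i' + (m - j'))%N by exact: E0.
have := ltn_ord j; have := ltn_ord j' => jm' jm.
have [ii'|i'i|ii'] := ltngtP i i'.
- by case: (chain _ _ Te Tf ii') => /=; lia.
- by case: (chain _ _ Tf Te i'i) => /=; lia.
- by congr pair; apply: val_inj => //=; lia.
Qed.

Lemma monge_card_bound (R : realType) (G : sgraph) (ell : {set G} -> R)
    (m : nat) (a b : 'I_m -> G) (D : 'I_m -> 'I_m -> R) :
  nonneg_lengths ell -> K33_crossing G ->
  (forall i j, dist ell (a i) (b j) = (D i j)%:E) ->
  (forall i i' j j' : 'I_m, (i < i')%N -> (j < j')%N ->
    D i j + D i' j' < D i j' + D i' j) ->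
  (m ^ 2 <= 324 * #|G|)%N.
Proof.
move=> ell0 K dD monge.
have [->//|m0] := posnP m.
have /choice[P HP] e := dist_attained (dD e.1 e.2).
pose T (v : G) : pred ('I_m * 'I_m) := fun e => v \in a e.1 :: P e.
have T_chain v e f : T v e -> T v f -> (e.1 < f.1)%N -> (e.2 < f.2)%N -> False.
  move=> ve vf ef1 ef2; have := monge _ _ _ _ ef1 ef2.
  have [p1 l1] := HP e; have [p2 l2] := HP f.
  have := dist_exchange ell0 p1 p2 ve vf.
  by rewrite !dD -EFinD lee_fin l1 l2 ltNge => ->.
pose A := {ffun 'I_3 -> 'I_m}.
have key (xy : A * A) : exists z : ('I_3 * 'I_3) * ('I_3 * 'I_3) * G,
    [/\ z.1.1.1 != z.1.2.1, z.1.1.2 != z.1.2.2,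
        T z.2 (xy.1 z.1.1.1, xy.2 z.1.1.2) &
        T z.2 (xy.1 z.1.2.1, xy.2 z.1.2.2)].
  case: xy => x y /=.
  have [||i [j [k [l [ik jl [v [v1 v2]]]]]]] :=
    K (a \o x) (b \o y) (fun i j => P (x i, y j)).
  - by move=> i j; have [/and3P[]] := HP (x i, y j).
  - by move=> i j; have [/and3P[_ _ /eqP]] := HP (x i, y j).
  by exists ((i, j), (k, l), v).
have {key} [z Hz] := choice key.
pose code (xy : A * A) := let: ((i, j), (k, l), v) := z xy in
  (z xy, diagonal (xy.1 i, xy.2 j), diagonal (xy.1 k, xy.2 l),
   xy.1 (inord (3 - i - k)), xy.2 (inord (3 - j - l))).
have code_inj : injective code.
  move=> [x y] [x' y']; have := Hz (x', y'); have := Hz (x, y); rewrite /code.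
  case: (z (x, y)) => -[[i j] [k l]] v; case: (z (x', y')) => -[[i' j'] [k' l']] v'.
  move=> /= [ik jl T1 T2] [_ _ T1' T2'] [? ? ? ? ?]; subst => e1 e2 xg yg.
  have [xi yj] : (x i', y j') = (x' i', y' j').
    by apply: (diagonal_inj (@T_chain v')) T1 T1' _; exact: val_inj.
  have [xk yl] : (x k', y l') = (x' k', y' l').
    by apply: (diagonal_inj (@T_chain v')) T2 T2' _; exact: val_inj.
  by congr pair; [apply: (ffun3_eq ik) | apply: (ffun3_eq jl)].
have := leq_card code code_inj.
rewrite !card_prod !card_ffun !card_ord; nia.
Qed.

(** * The grid *)

Section GridDrawing.
Local Open Scope classical_set_scope.
Variables (R : realType) (k : nat).

Definition grid_pos (x : grid k) : R * R := ((x.1 : nat)%:R, (x.2 : nat)%:R).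

Definition grid_arc (x y : grid k) (t : R) : R * R :=
  ((1 - t) * (grid_pos x).1 + t * (grid_pos y).1,
   (1 - t) * (grid_pos x).2 + t * (grid_pos y).2).

Lemma nat_frac_inj (n n' : nat) (u u' : R) : 0 <= u < 1 -> 0 <= u' < 1 ->
  n%:R + u = n'%:R + u' -> n = n' /\ u = u'.
Proof.
move=> /andP[u0 u1] /andP[u'0 u'1] E.
have [nn'|n'n|nn'] := ltngtP n n'.
- have : n.+1%:R <= n'%:R :> R by rewrite ler_nat.
  by rewrite -natr1; lra.
- have : n'.+1%:R <= n%:R :> R by rewrite ler_nat.
  by rewrite -natr1; lra.
- by split=> //; move: E; rewrite nn' => /addrI.
Qed.

Lemma grid_arcP (x y : grid k) t : adj x y -> 0 < t < 1 ->
  exists p q : grid k, exists a b, [/\ [set x; y]%SET = [set p; q]%SET,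
    grid_arc x y t = ((grid_pos p).1 + a, (grid_pos p).2 + b) &
    [/\ q.1 = p.1, (q.2 : nat) = p.2.+1, a = 0 & 0 < b < 1] \/
    [/\ q.2 = p.2, (q.1 : nat) = p.1.+1, 0 < a < 1 & b = 0]].
Proof.
move=> xy t01; have t01' : 0 < 1 - t < 1 by lra.
move: x y xy => [x1 x2] [y1 y2]; rewrite /adj /= /grid_adj /= /consecutive.
case/orP=> /andP[/eqP E] /orP[] /eqP F; rewrite E in F * => {E}.
- exists (y1, x2), (y1, y2), 0, t; split=> //; last by left.
  by rewrite /grid_arc /= -F -natr1; congr pair; ring.
- exists (y1, y2), (y1, x2), 0, (1 - t); split; last by left.
    by rewrite finset.setUC.
  by rewrite /grid_arc /= -F -natr1; congr pair; ring.
- exists (x1, y2), (y1, y2), t, 0; split=> //; last by right.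
  by rewrite /grid_arc /= -F -natr1; congr pair; ring.
- exists (y1, y2), (x1, y2), (1 - t), 0; split; last by right.
    by rewrite finset.setUC.
  by rewrite /grid_arc /= -F -natr1; congr pair; ring.
Qed.

Lemma grid_pos_frac_inj (p p' : grid k) (a b a' b' : R) :
  0 <= a < 1 -> 0 <= b < 1 -> 0 <= a' < 1 -> 0 <= b' < 1 ->
  ((grid_pos p).1 + a, (grid_pos p).2 + b) =
  ((grid_pos p').1 + a', (grid_pos p').2 + b') -> [/\ p = p', a = a' & b = b'].
Proof.
move: p p' => [p1 p2] [p1' p2'] a01 b01 a01' b01' [E1 E2].
have [/val_inj -> ->] := nat_frac_inj a01 a01' E1.
by have [/val_inj -> ->] := nat_frac_inj b01 b01' E2.
Qed.

Lemma grid_pos_inj : injective grid_pos.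
Proof.
move=> p q E; have z : 0 <= (0 : R) < 1 by rewrite lexx ltr01.
have [|//] := @grid_pos_frac_inj p q 0 0 0 0 z z z z.
by rewrite E.
Qed.

Lemma planar_grid : planar R (grid k).
Proof.
exists grid_pos, grid_arc; split.
- exact: grid_pos_inj.
- move=> x y _; apply: continuous_subspaceT => t.
  have line (c d : R) : (1 - s) * c + s * d @[s --> t] --> (1 - t) * c + t * d.
    apply: cvgD; apply: cvgMl; last exact: cvg_id.
    by apply: cvgB; [exact: cvg_cst | exact: cvg_id].
  exact: cvg_pair (line _ _) (line _ _).
- move=> x y xy s t s01 t01; have : grid_pos x != grid_pos y.
    by apply: contraTneq xy => /grid_pos_inj ->; rewrite adj_irrefl.
  rewrite /grid_arc; case: (grid_pos x) => a b; case: (grid_pos y) => c d /=.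
  move=> nxy [E1 E2]; apply/eqP; move: nxy; apply: contraNT => st; apply/eqP.
  have st0 : s - t != 0 by rewrite subr_eq0.
  have /eqP h1 : (s - t) * (a - c) = 0 by lra.
  have /eqP h2 : (s - t) * (b - d) = 0 by lra.
  move: h1 h2; rewrite !mulf_eq0 (negbTE st0) /= !subr_eq0.
  by move=> /eqP -> /eqP ->.
- by move=> x y _; rewrite /grid_arc /grid_pos /=; congr pair; ring.
- by move=> x y _; rewrite /grid_arc /grid_pos /=; congr pair; ring.
- by move=> x y _ t _; rewrite /grid_arc /=; congr pair; ring.
- move=> x y z t xy t01; have [p [q [a [b [_ -> H]]]]] := grid_arcP xy t01.
  have -> : grid_pos z = ((grid_pos z).1 + 0, (grid_pos z).2 + 0).
    by rewrite !addr0 -surjective_pairing.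
  case: H => -[_ _] => [-> b01|a01 ->] /grid_pos_frac_inj[]; lra.
- move=> x y x' y' s t xy xy' N s01 t01.
  have [p [q [a [b [E -> H]]]]] := grid_arcP xy s01.
  have [p' [q' [a' [b' [E' -> H']]]]] := grid_arcP xy' t01.
  move=> F; move: N; rewrite E E'; apply/negP; rewrite negbK.
  have [||||pp' aa' bb'] := grid_pos_frac_inj _ _ _ _ F.
  + by case: H => -[]; lra.
  + by case: H => -[]; lra.
  + by case: H' => -[]; lra.
  + by case: H' => -[]; lra.
  rewrite pp' in H *; suff -> : q = q' by [].
  case: H => -[h1 h2 h3 h4]; case: H' => -[h1' h2' h3' h4'].
  - rewrite [q]surjective_pairing [q']surjective_pairing h1 h1'.
    by congr pair; apply: ord_inj; rewrite h2 h2'.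
  - by move: h3'; rewrite -aa' h3 ltxx.
  - by move: h3; rewrite aa' h3' ltxx.
  - rewrite [q]surjective_pairing [q']surjective_pairing h1 h1'.
    by congr pair; apply: ord_inj; rewrite h2 h2'.
Qed.

End GridDrawing.

Section GridLengths.
Variables (R : realType) (k : nat).

(* Edges of row [i] and of column [i] have length [2k - i], so that the
   shortest walk from [(i, 0)] to [(0, j)] turns at [(i, j)] only. *)
Definition grid_weight (x y : grid k) : R :=
  (2 * k)%:R - (if x.1 == y.1 then x.1 : nat else minn x.2 y.2)%:R.

Definition grid_length (s : {set grid k}) : R :=
  if [pick e : grid k * grid k | s == [set e.1; e.2]%SET] is Some e
  then grid_weight e.1 e.2 else 0.

Lemma grid_weightC x y : grid_weight x y = grid_weight y x.
Proof. by rewrite /grid_weight eq_sym minnC; case: eqP => // ->. Qed.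

Lemma grid_lengthE x y : grid_length [set x; y]%SET = grid_weight x y.
Proof.
rewrite /grid_length; case: pickP => [[a b] /= /eqP /setP E|/(_ (x, y))]; last first.
  by rewrite eqxx.
have := E x; have := E y; have := E a; have := E b; rewrite !inE !eqxx !orbT /=.
move=> /orP[] /eqP -> /orP[] /eqP -> Ey Ex.
- by move: Ey; rewrite orbb => /esym/eqP ->.
- exact: grid_weightC.
- by [].
- by move: Ex; rewrite orbb => /esym/eqP ->.
Qed.

Lemma grid_length_ge0 : nonneg_lengths grid_length.
Proof.
move=> x y _; rewrite grid_lengthE subr_ge0 ler_nat.
by have := ltn_ord x.1; have := ltn_ord x.2; case: eqP; lia.
Qed.

(* A potential, 1-Lipschitz for the lengths, certifying that walks from
   [(i, 0)] to [(0, j)] are no shorter than the one turning at [(i, j)]. *)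
Definition grid_potential (i j x1 x2 : nat) : R :=
  ((2 * k)%:R - (maxn x1 i)%:R) * (minn x2 j)%:R -
  ((2 * k)%:R - (maxn x2 j)%:R) * (minn x1 i)%:R.

Lemma grid_potential_step i j x1 x2 : (i < k)%N -> (j < k)%N ->
  (x1 < k)%N -> (x2 < k)%N ->
  `|grid_potential i j x1 x2.+1 - grid_potential i j x1 x2| <= (2 * k)%:R - x1%:R.
Proof.
move=> ik jk x1k x2k.
have le_k (n : nat) : (n < k)%N -> 0 <= (n%:R : R) <= k%:R.
  by move=> nk; rewrite ler0n ler_nat ltnW.
have hi := le_k _ ik; have hj := le_k _ jk; have h1 := le_k _ x1k.
have h2 := le_k _ x2k; rewrite /grid_potential natrM.
have [x2j|jx2] := ltnP x2 j.
  rewrite (minn_idPl x2j) (maxn_idPr x2j) -natr1 ler_norml.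
  by case: (leqP x1 i) => [|/ltnW]; rewrite -(ler_nat R) => x1i;
    apply/andP; split; lra.
rewrite (minn_idPr (leqW jx2)) (maxn_idPl (leqW jx2)) -natr1 ler_norml.
by case: (leqP x1 i) => [|/ltnW]; rewrite -(ler_nat R) => x1i;
  apply/andP; split; lra.
Qed.

Lemma grid_potential_swap i j x1 x2 :
  grid_potential i j x1 x2 = - grid_potential j i x2 x1.
Proof. by rewrite /grid_potential; ring. Qed.

Lemma grid_potential_le i j (x y : grid k) : (i < k)%N -> (j < k)%N ->
  adj x y ->
  grid_potential i j y.1 y.2 - grid_potential i j x.1 x.2 <= grid_weight x y.
Proof.
move=> ik jk; move: x y => [x1 x2] [y1 y2]; rewrite /grid_weight /=.
rewrite /adj /= /grid_adj /= /consecutive.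
case/orP=> /andP[/eqP E].
  rewrite E eqxx => /orP[/eqP F|/eqP F].
    rewrite -F; apply: le_trans (ler_norm _) _.
    exact: grid_potential_step.
  rewrite -F; apply: le_trans (ler_norm _) _; rewrite distrC.
  exact: grid_potential_step.
rewrite E minnn => cons; rewrite ifN; last first.
  by apply: contraTneq cons => ->; rewrite orbb gtn_eqF.
rewrite !(grid_potential_swap i j) opprK.
case/orP: cons => /eqP F; rewrite -F; apply: le_trans (ler_norm _) _.
  by rewrite addrC distrC; exact: grid_potential_step.
by rewrite addrC; exact: grid_potential_step.
Qed.

Lemma grid_potential_walk i j (x : grid k) p : (i < k)%N -> (j < k)%N ->
  path adj x p ->
  grid_potential i j (last x p).1 (last x p).2 - grid_potential i j x.1 x.2 <=
    walk_length grid_length x p.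
Proof.
move=> ik jk; elim: p x => [|y p IH] x /=; first by rewrite subrr.
case/andP=> /(grid_potential_le ik jk) h /IH; rewrite grid_lengthE; lra.
Qed.

Definition walkable (x y : grid k) (d : R) : Prop :=
  exists p, [/\ path adj x p, last x p = y & walk_length grid_length x p = d].

Lemma walkable_edge x y z d : walkable x y d -> adj y z ->
  walkable x z (d + grid_weight y z).
Proof.
move=> [p [xp lp pd]] yz; exists (rcons p z).
by rewrite rcons_path last_rcons xp lp yz -cats1 walk_length_cat lp pd /= addr0
  grid_lengthE.
Qed.

Lemma walkable_trans x y z d e :
  walkable x y d -> walkable y z e -> walkable x z (d + e).
Proof.
move=> [p [xp lp pd]] [q [yq lq qe]]; exists (p ++ q).
by rewrite cat_path last_cat walk_length_cat lp xp yq lq pd qe.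
Qed.

Lemma walkable_row n (x y : grid k) : x.1 = y.1 -> (y.2 = x.2 + n :> nat)%N ->
  walkable x y (n%:R * ((2 * k)%:R - (x.1 : nat)%:R)).
Proof.
elim: n y => [|n IH] [y1 y2] /= xy1 xy2.
  exists [::]; split=> //=; last by rewrite mul0r.
  by rewrite [x]surjective_pairing xy1; congr pair; apply: ord_inj; rewrite xy2 addn0.
have ny2 : (y2.-1 < k)%N by apply: leq_ltn_trans (leq_pred _) (ltn_ord y2).
have ey2 : (y2.-1 = x.2 + n)%N by rewrite xy2 addnS.
have w := IH (y1, Ordinal ny2) xy1 ey2.
have yy : adj ((y1, Ordinal ny2) : grid k) (y1, y2).
  have y2S : (y2.-1.+1 = y2)%N by rewrite prednK // xy2 addnS.
  by rewrite /adj /= /grid_adj /= /consecutive y2S !eqxx.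
have := walkable_edge w yy; rewrite /grid_weight /= eqxx -xy1.
by rewrite -natr1 mulrDl mul1r.
Qed.

Lemma walkable_col n (x y : grid k) : x.2 = y.2 -> (x.1 = y.1 + n :> nat)%N ->
  walkable x y (n%:R * ((2 * k)%:R - (x.2 : nat)%:R)).
Proof.
elim: n x => [|n IH] [x1 x2] /= xy2 xy1.
  exists [::]; split=> //=; last by rewrite mul0r.
  by rewrite [y]surjective_pairing xy2; congr pair; apply: ord_inj; rewrite xy1 addn0.
have nx1 : (x1.-1 < k)%N by apply: leq_ltn_trans (leq_pred _) (ltn_ord x1).
have ex1 : (x1.-1 = y.1 + n)%N by rewrite xy1 addnS.
have w := IH (Ordinal nx1, x2) xy2 ex1.
have xx : adj ((x1, x2) : grid k) (Ordinal nx1, x2).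
  have x1S : (x1.-1.+1 = x1)%N by rewrite prednK // xy1 addnS.
  by rewrite /adj /= /grid_adj /= /consecutive x1S !eqxx !orbT.
have w0 : walkable (x1, x2) (x1, x2) 0 by exists [::].
have := walkable_trans (walkable_edge w0 xx) w.
rewrite add0r /grid_weight /= ifN; last first.
  by rewrite -val_eqE /= xy1 addnS; lia.
by rewrite minnn -natr1 mulrDl mul1r addrC.
Qed.

Lemma grid_dist (x y : grid k) : x.2 = 0%N :> nat -> y.1 = 0%N :> nat ->
  dist grid_length x y =
    ((y.2 : nat)%:R * ((2 * k)%:R - (x.1 : nat)%:R) +
     (x.1 : nat)%:R * ((2 * k)%:R - (y.2 : nat)%:R))%:E.
Proof.
move=> x20 y10; apply/eqP; rewrite eq_le; apply/andP; split.
  have [p [xp lp <-]] := walkable_trans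
    (@walkable_row y.2 x (x.1, y.2) erefl (esym (congr1 (addn^~ _) x20)))
    (@walkable_col x.1 (x.1, y.2) y erefl (esym (congr1 (addn^~ _) y10))).
  by rewrite -lp; apply: dist_le_walk => //; exact: grid_length_ge0.
apply/ereal_infP => _ [p /and3P[xp _ /eqP lp] <-]; rewrite lee_fin.
apply: le_trans (grid_potential_walk (ltn_ord x.1) (ltn_ord y.2) xp).
rewrite lp /grid_potential x20 y10 min0n minnn max0n maxnn.
by rewrite min0n maxnn minnn max0n; lra.
Qed.

End GridLengths.

Section GridTerminals.
Variable k : nat.

Lemma grid_terminal_row (t : 'I_k) : (t.+1 - (k - k./2) < k)%N.
Proof. by have := ltn_ord t; lia. Qed.

Lemma grid_terminal_col (t : 'I_k) :
  ((if (t < k - k./2)%N then t : nat else 0) < k)%N.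
Proof. by have := ltn_ord t; case: ifP => _; lia. Qed.

Definition grid_terminal (t : 'I_k) : grid k :=
  (Ordinal (grid_terminal_row t), Ordinal (grid_terminal_col t)).

Lemma grid_terminal_inj : injective grid_terminal.
Proof.
move=> s t [E F]; apply: ord_inj.
by have := ltn_ord s; have := ltn_ord t; move: E F; do 2 case: ifP; lia.
Qed.

Definition grid_terminals : {set grid k} := [set grid_terminal t | t in 'I_k].

Lemma card_grid_terminals : #|grid_terminals| = k.
Proof. by rewrite card_imset ?card_ord //; exact: grid_terminal_inj. Qed.

Lemma grid_terminal_in t : grid_terminal t \in grid_terminals.
Proof. exact: imset_f. Qed.

Lemma grid_terminals_bound (R : realType) (H : sgraph) (ellH : {set H} -> R)
    (t : terminals grid_terminals -> H) : (0 < k)%N ->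
  K33_crossing H -> nonneg_lengths ellH ->
  preserves_dist (@grid_length R k) ellH t -> (k ^ 2 <= 2916 * #|H|)%N.
Proof.
move=> k0 KH ellH0 distH.
pose term s : terminals grid_terminals :=
  exist _ (grid_terminal s) (grid_terminal_in s).
have arow (i : 'I_k./2) : (i + (k - k./2) < k)%N.
  by have := ltn_ord i; lia.
have bcol (j : 'I_k./2) : (j < k)%N by have := ltn_ord j; lia.
pose a i := t (term (Ordinal (arow i))).
pose b j := t (term (Ordinal (bcol j))).
pose D (i j : 'I_k./2) : R := (j : nat)%:R * ((2 * k)%:R - i.+1%:R) +
  i.+1%:R * ((2 * k)%:R - (j : nat)%:R).
have abD i j : dist ellH (a i) (b j) = (D i j)%:E.
  rewrite distH grid_dist /= /D.
  - have -> : ((i + (k - k./2)).+1 - (k - k./2) = i.+1)%N by lia.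
    by rewrite ifT //; have := ltn_ord j; lia.
  - by rewrite ifF //; apply/negbTE; lia.
  - by have := ltn_ord j; lia.
have monge (i i' j j' : 'I_k./2) : (i < i')%N -> (j < j')%N ->
    D i j + D i' j' < D i j' + D i' j.
  move=> ii' jj'.
  have h1 : i%:R + 1 <= i'%:R :> R by rewrite natr1 ler_nat.
  have h2 : j%:R + 1 <= j'%:R :> R by rewrite natr1 ler_nat.
  by rewrite /D -!natr1; nra.
have bound := monge_card_bound ellH0 KH abD monge.
have H0 : (0 < #|H|)%N by apply/card_gt0P; exists (t (term (Ordinal k0))).
have := odd_double_half k; rewrite -muln2; move: bound H0.
case: (odd k) => /=; nia.
Qed.

End GridTerminals.

Theorem theorem6 (R : realType) :
  exists c : R, 0 < c /\
    forall k : nat, (0 < k)%N ->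
      (planar R (grid k) /\
       exists (ell : {set grid k} -> R) (S : {set grid k}),
         [/\ nonneg_lengths ell,
             #|S| = k
           & forall (H : sgraph) (ellH : {set H} -> R) (t : terminals S -> H),
               planar R H -> nonneg_lengths ellH -> injective t ->
               preserves_dist ell ellH t ->
               c * (k%:R ^+ 2) <= #|H|%:R])
      /\ ((c * (k%:R ^+ 2))%:E <= fstar R k (planar R))%E.
Proof.
have scale (n k : nat) : (k ^ 2 <= 2916 * n)%N ->
    2916%:R^-1 * k%:R ^+ 2 <= n%:R :> R.
  move=> kn; rewrite mulrC ler_pdivrMr ?ltr0n // -natrX -natrM ler_nat.
  by rewrite mulnC.
exists 2916%:R^-1; split=> [|k k0]; first by rewrite invr_gt0 ltr0n.
split; first split; first exact: planar_grid.
  exists (@grid_length R k), (grid_terminals k); split.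
  - exact: grid_length_ge0.
  - exact: card_grid_terminals.
  - move=> H ellH t /planar_K33_crossing KH ellH0 _ distH; apply: scale.
    exact: grid_terminals_bound distH.
apply/ereal_infP => _ [n bound_n <-]; rewrite lee_fin; apply: scale.
have [G' [ell' [t [[ell'0 minor distG'] G'n]]]] := bound_n (grid k)
  (@grid_length R k) (grid_terminals k) (@planar_grid R k)
  (@grid_length_ge0 R k) (@card_grid_terminals k).
apply: leq_trans (_ : 2916 * #|G'| <= _)%N; last by rewrite leq_mul2l G'n.
apply: grid_terminals_bound distG' => //.
exact: K33_crossing_minor minor (planar_K33_crossing (@planar_grid R k)).
Qed.
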